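(* Let $\mathcal X=([v],\{R_i\}_{i=0}^d)$ be a symmetric association scheme. Let $k$ be a positive integer and let $A$ be a $v\times v$ complex diagonalisable matrix such that (1) $D_A(k)=\{a,b\}$ with $a\neq b$, and (2) for each $i\in\{0,1\}$ there is a constant $c_i$ with $c_A(\alpha,k)=c_i$ for all $\alpha\in\binom{[v]}{i}$, and for each $j\in\{1,\dots,d\}$ there is a constant $c_2(j)$ with $c_A(\alpha,k)=c_2(j)$ for all $\alpha\in\tilde R_j$. Then the hypergraph $\mathfrak H_A(v,k,a)$ is a $\operatorname{PBIBD}(v,k;\lambda_1,\dots,\lambda_d)$ on $\mathcal X$ with $$\lambda_i=\frac{(-1)^k}{a-b}\bigl(c_0-2c_1+c_2(i)\bigr)-\frac{b}{a-b}\binom{v-2}{k-2}\qquad (i=1,\dots,d).$$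
   Context: $[v]=\{1,\dots,v\}$; $\binom{[v]}{k}$ is the set of $k$-subsets of $[v]$. For a $v\times v$ matrix $A$ and $\alpha\subset[v]$, $A[\alpha]$ is the principal submatrix indexed by $\alpha$ and $\overline\alpha=[v]\setminus\alpha$. $D_A(k)=\{\det(A[\alpha]):\alpha\in\binom{[v]}{k}\}$. $c_A(\alpha,k)$ is the coefficient of $x^{v-k-|\alpha|}$ in $\det(xI-A[\overline\alpha])$. $\mathfrak H_A(v,k,a)$ is the $k$-uniform hypergraph on $[v]$ whose hyperedges are the $k$-subsets $\alpha$ with $\det(A[\alpha])=a$. A symmetric association scheme with $d\ge1$ classes on a finite set $\mathfrak X$ is $(\mathfrak X,\{R_i\}_{i=0}^d)$, with $R_i$ nonempty subsets of $\mathfrak X\times\mathfrak X$ whose $\{0,1\}$ adjacency matrices $A_i$ (with $(A_i)_{xy}=1$ iff $(x,y)\in R_i$) satisfy: $A_0=I$; $\sum_{i=0}^dA_i=J$ (all-ones); $A_i^{\top}=A_i$ for all $i$; and every product $A_iA_j$ lies in the linear span of $A_0,\dots,A_d$. Write $\tilde R_i=\{\{x,y\}:(x,y)\in R_i\}$. A $\operatorname{PBIBD}(v,k;\lambda_1,\dots,\lambda_d)$ (partially balanced incomplete block design) on this scheme, $|\mathfrak X|=v$, is a $k$-uniform hypergraph $(\mathfrak X,\mathfrak B)$ that is a $1$-design (every vertex lies in the same positive number of hyperedges) and such that for each $i\in\{1,\dots,d\}$ and each $(x,y)\in R_i$, the pair $\{x,y\}$ is contained in exactly $\lambda_i$ hyperedges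 ($\lambda_i\geq0$). *)

(* Defs.v *)
From mathcomp Require Import all_boot all_order all_algebra.
From mathcomp Require Import complex reals.

Set Implicit Arguments.
Unset Strict Implicit.
Unset Printing Implicit Defensive.

Import GRing.Theory Num.Theory.
Local Open Scope ring_scope.

(* The vertex set [v] = {1, ..., v} is represented by 'I_v = {0, ..., v - 1}. *)

Definition psubmx (F : nzRingType) (v : nat) (A : 'M[F]_v) (s : {set 'I_v}) :
    'M[F]_#|s| :=
  \matrix_(i, j) A (enum_val i) (enum_val j).

Definition DA (F : comNzRingType) (v : nat) (A : 'M[F]_v) (k : nat) : seq F :=
  [seq \det (psubmx A s) | s : {set 'I_v} in [set s : {set 'I_v} | #|s| == k]].

(* The indices v - k - |alpha| and k - 2 below may be negative. They are taken
   in int, and coefficients and binomials of negative index are 0. *)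
Definition coefz (F : nzRingType) (p : {poly F}) (m : int) : F :=
  if m is Posz n then p`_n else 0.

Definition binz (n : nat) (m : int) : nat :=
  if m is Posz j then 'C(n, j) else 0%N.

Definition cA (F : comNzRingType) (v : nat) (A : 'M[F]_v) (s : {set 'I_v})
    (k : nat) : F :=
  coefz (char_poly (psubmx A (~: s))) (v%:Z - k%:Z - #|s|%:Z).

Definition HA (F : comNzRingType) (v : nat) (A : 'M[F]_v) (k : nat) (a : F) :
    {set {set 'I_v}} :=
  [set s : {set 'I_v} | (#|s| == k) && (\det (psubmx A s) == a)].

Definition adjmx (F : nzRingType) (v : nat) (E : {set 'I_v * 'I_v}) :
    'M[F]_v :=
  \matrix_(x, y) ((x, y) \in E)%:R.

Record assoc_scheme (F : numFieldType) (v d : nat) := AssocScheme {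
  rel_of :> 'I_d.+1 -> {set 'I_v * 'I_v};
  scheme_classes : (0 < d)%N;
  scheme_neq0 : forall i, rel_of i != set0;
  scheme_id : adjmx F (rel_of ord0) = 1%:M;
  scheme_sum : \sum_i adjmx F (rel_of i) = const_mx 1;
  scheme_sym : forall i, (adjmx F (rel_of i))^T = adjmx F (rel_of i);
  scheme_mul : forall i j,
    adjmx F (rel_of i) *m adjmx F (rel_of j)
      \in <<[seq adjmx F (rel_of l) | l : 'I_d.+1]>>%VS
}.

Definition pairs_of (v : nat) (E : {set 'I_v * 'I_v}) : {set {set 'I_v}} :=
  [set [set p.1; p.2] | p in E].

Definition uniform (v k : nat) (H : {set {set 'I_v}}) : Prop :=
  forall B, B \in H -> #|B| = k.

Definition one_design (v : nat) (H : {set {set 'I_v}}) : Prop :=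
  exists2 r : nat, (0 < r)%N &
    forall x : 'I_v, #|[set B in H | x \in B]| = r.

(* The classes 1, ..., d are the indices lift ord0 i for i : 'I_d; thus
   lambda i stands for lambda_(i+1). *)
Record PBIBD (F : numFieldType) (v d : nat) (X : assoc_scheme F v d) (k : nat)
    (lambda : 'I_d -> nat) (H : {set {set 'I_v}}) : Prop := {
  pbibd_uniform : uniform k H;
  pbibd_one_design : one_design H;
  pbibd_pairs : forall (i : 'I_d) (x y : 'I_v), (x, y) \in X (lift ord0 i) ->
    #|[set B in H | [set x; y] \subset B]| = lambda i
}.

(* Main.v *)
(** The coefficient of x^(n-k) in the characteristic polynomial of an n x n
    matrix is (-1)^k times the sum of its principal k-minors, so
    (-1)^k c_A(alpha, k) is the sum of det A[S] over the k-sets S disjoint from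
    alpha. By inclusion-exclusion, the sum of det A[S] over the k-sets S
    containing x and y is (-1)^k (c0 - 2 c1 + c2(i)) for (x, y) in R_i. As every
    minor is a or b, this sum also equals a lambda + b (C(v-2, k-2) - lambda),
    where lambda counts the hyperedges through x and y, which determines lambda.
    The same argument with a single vertex gives the 1-design property. *)

Require Import Defs.
From mathcomp Require Import all_boot all_order all_algebra.
From mathcomp Require Import complex reals.
From mathcomp Require Import all_fingroup zify ring.
Set Implicit Arguments.
Unset Strict Implicit.
Unset Printing Implicit Defensive.
Local Open Scope ring_scope.
Local Open Scope complex_scope.

Import GRing.Theory Num.Theory.

(** Both sides equal the determinant of the block matrix with rows [1, -U] and [V, 1], by
    eliminating one off-diagonal block or the other. *)
Lemma det_add1_mulmxC (F : comNzRingType) (m n : nat)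
    (U : 'M[F]_(m, n)) (V : 'M[F]_(n, m)) :
  \det (1%:M + U *m V) = \det (1%:M + V *m U).
Proof.
have detL : \det (block_mx 1%:M (- U) V 1%:M) = \det (1%:M + V *m U).
  have -> : block_mx 1%:M (- U) V 1%:M =
      block_mx 1%:M 0 V 1%:M *m block_mx 1%:M (- U) 0 (1%:M + V *m U).
    rewrite mulmx_block !mul1mx !mul0mx !mulmx1 !addr0 mulmxN.
    by rewrite addrC addrK.
  by rewrite det_mulmx det_lblock det_ublock !det1 !mul1r.
rewrite -detL.
have -> : block_mx 1%:M (- U) V 1%:M =
    block_mx 1%:M (- U) 0 1%:M *m block_mx (1%:M + U *m V) 0 V 1%:M.
  rewrite mulmx_block !mul1mx !mul0mx !mulmx1 !add0r mulNmx.
  by rewrite addrK.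
by rewrite det_mulmx det_lblock det_ublock !det1 !mul1r mulr1.
Qed.

(** Padding with identity rows turns minors of all sizes into [v] by [v] determinants, which expand
    over the same permutations. *)
Definition idrows (F : nzRingType) (v : nat) (S : {set 'I_v}) (B : 'M[F]_v) :
    'M[F]_v :=
  \matrix_(i, j) if i \in S then B i j else (i == j)%:R.

Lemma det_idrows (F : comNzRingType) (v : nat) (S : {set 'I_v}) (B : 'M[F]_v) :
  \det (idrows S B) = \det (psubmx B S).
Proof.
(* With [E] the selector of the rows in [S], the two matrices are
   [1 + E^T (E B - E)] and [1 + (E B - E) E^T]. *)
pose E : 'M[F]_(#|S|, v) := \matrix_(i, j) (enum_val i == j)%:R.
have EM m (C : 'M[F]_(v, m)) i j : (E *m C) i j = C (enum_val i) j.
  rewrite mxE (bigD1 (enum_val i)) //= mxE eqxx mul1r big1 ?addr0 // => l nl.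
  by rewrite mxE eq_sym (negPf nl) mul0r.
have EEt : E *m E^T = 1%:M.
  by apply/matrixP=> i j; rewrite EM !mxE eq_sym (inj_eq enum_val_inj).
have -> : idrows S B = 1%:M + E^T *m (E *m B - E).
  apply/matrixP=> i j; rewrite !mxE.
  case: ifP => iS.
    have [r rE] : exists r : 'I_(#|S|), enum_val r = i.
      by exists (enum_rank_in iS i); rewrite enum_rankK_in.
    rewrite (bigD1 r) //= big1 => [|l nl].
      by rewrite mxE mxE rE eqxx mul1r addr0 mxE EM mxE mxE rE addrC subrK.
    by rewrite mxE mxE -rE (inj_eq enum_val_inj) (negPf nl) mul0r.
  rewrite big1 ?addr0 // => l _; rewrite !mxE.
  case: eqP => [e|_]; last by rewrite mul0r.
  by rewrite -e enum_valP in iS.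
rewrite det_add1_mulmxC mulmxBl EEt addrC subrK; congr (\det _).
apply/matrixP=> i j; rewrite -mulmxA EM !mxE.
rewrite (bigD1 (enum_val j)) //= !mxE eqxx mulr1 big1 ?addr0 // => l nl.
by rewrite !mxE eq_sym (negPf nl) mulr0.
Qed.

(** For each permutation, expand the product over the rows in [T] by choosing the entry of [B] or
    that of [x%:M]; [S] is the set of rows where [B] is chosen. *)
Lemma det_psubmx_addscalar (F : comNzRingType) (v : nat) (T : {set 'I_v})
    (x : F) (B : 'M[F]_v) :
  \det (psubmx (x%:M + B) T) =
    \sum_(S : {set 'I_v} | S \subset T) x ^+ #|T :\: S| * \det (psubmx B S).
Proof.
under eq_bigr do rewrite -det_idrows.
rewrite -det_idrows.
pose f (s : 'S_v) (i : 'I_v) : F := if i \in T then B i (s i) else 0.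
pose g (s : 'S_v) (i : 'I_v) : F :=
  if i \in T then x * (i == s i)%:R else (i == s i)%:R.
have expand (s : 'S_v) : \prod_i idrows T (x%:M + B) i (s i) =
    \sum_(S : {set 'I_v} | S \subset T)
      x ^+ #|T :\: S| * \prod_i idrows S B i (s i).
  transitivity (\prod_i (f s i + g s i)).
    apply: eq_bigr => i _; rewrite !mxE /f /g; case: ifP => _.
      by rewrite addrC mulr_natr.
    by rewrite add0r.
  (* Since [f] vanishes outside [T], only the choices [S \subset T] survive. *)
  rewrite bigA_distr (bigID (fun S : {set 'I_v} => S \subset T)) /=.
  rewrite [X in _ + X]big1 ?addr0 => [|S /subsetPn[i iS niT]]; last first.
    by rewrite (bigD1 i) //= iS /f (negPf niT) mul0r.
  apply: eq_bigr => S ST.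
  rewrite -prodr_const [\prod_(i in T :\: S) x]big_mkcond -big_split /=.
  apply: eq_bigr => i _; rewrite mxE inE /f /g.
  case: (boolP (i \in S)) => iS /=; first by rewrite (subsetP ST) // mul1r.
  by case: ifP; rewrite ?mul1r.
rewrite /determinant (eq_bigr _ (fun s _ => congr1 _ (expand s))).
under eq_bigr do rewrite mulr_sumr.
rewrite exchange_big; apply: eq_bigr => S ST /=.
rewrite mulr_sumr; apply: eq_bigr => s _.
by rewrite mulrCA.
Qed.

Lemma char_poly_psubmx (F : comNzRingType) (v : nat) (T : {set 'I_v})
    (A : 'M[F]_v) :
  char_poly (psubmx A T) =
    \sum_(S : {set 'I_v} | S \subset T)
      ((-1) ^+ #|S| * \det (psubmx A S)) *: 'X^#|T :\: S|.
Proof.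
(* Apply the expansion over polynomials with [x = 'X] and [B = - A]; the minors of [- A] give the
   signs. *)
have -> : char_poly (psubmx A T) =
    \det (psubmx ('X%:M + map_mx polyC (- A)) T).
  congr (\det _); apply/matrixP=> i j; rewrite !mxE (inj_eq enum_val_inj).
  by rewrite polyCN.
rewrite det_psubmx_addscalar; apply: eq_bigr => S _.
rewrite -mul_polyC mulrC; congr (_ * _).
have -> : psubmx (map_mx polyC (- A)) S = map_mx polyC (- 1 *: psubmx A S).
  by apply/matrixP=> i j; rewrite !mxE mulN1r.
by rewrite det_map_mx detZ.
Qed.

Lemma cAE (F : comNzRingType) (v : nat) (A : 'M[F]_v) (s : {set 'I_v})
    (k : nat) :
  (-1) ^+ k * cA A s k =
    \sum_(S : {set 'I_v} | (#|S| == k) && (S \subset ~: s)) \det (psubmx A S).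
Proof.
have vE : v = (#|s| + #|~: s|)%N by rewrite cardsC card_ord.
(* If [~: s] has fewer than [k] elements, the sum is empty and the index of the coefficient is
   negative, so both sides are 0. *)
have [kle|klt] := leqP k #|~: s|; last first.
  rewrite [RHS]big_pred0 => [|S]; last first.
    apply/negbTE/negP => /andP[/eqP Sk /subset_leq_card].
    by rewrite Sk leqNgt klt.
  have : v%:Z - k%:Z - #|s|%:Z < 0 by lia.
  by rewrite /cA; case: (_ - _) => //= n _; rewrite mulr0.
have -> : cA A s k = (char_poly (psubmx A (~: s)))`_(#|~: s| - k).
  have E : v%:Z - k%:Z - #|s|%:Z = Posz (#|~: s| - k) by lia.
  by rewrite /cA E.
rewrite char_poly_psubmx coef_sum mulr_sumr.
under [RHS]eq_bigl do rewrite andbC.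
rewrite [RHS]big_mkcondr /=; apply: eq_bigr => S Ss.
rewrite coefZ coefXn cardsD (setIidPr Ss).
(* Neither subtraction truncates, as [k] and [#|S|] are at most [#|~: s|]. *)
have -> : (#|~: s| - k == #|~: s| - #|S|)%N = (#|S| == k).
  by move: (subset_leq_card Ss); lia.
case: eqP => [<-|_]; last by rewrite !mulr0.
by rewrite mulr1 mulrA -exprMn mulN1r opprK expr1n mul1r.
Qed.

(** For [#|t| <= k], the map [C -> t :|: C] is a bijection from the subsets of [~: t] of size
    [k - #|t|]; otherwise both sides are 0. *)
Lemma card_supersets (T : finType) (t : {set T}) (k : nat) :
  #|[set B : {set T} | (#|B| == k) && (t \subset B)]| =
    binz (#|T| - #|t|) (k%:Z - #|t|%:Z).
Proof.
have [tk|kt] := leqP #|t| k; last first.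
  rewrite (_ : [set B | _] = set0) ?cards0; last first.
    apply/setP=> B; rewrite !inE; apply/negbTE/negP => /andP[/eqP Bk].
    by move/subset_leq_card; rewrite Bk leqNgt kt.
  have : k%:Z - #|t|%:Z < 0 by lia.
  by case: (_ - _).
have -> : (#|T| - #|t|)%N = #|~: t| by rewrite [RHS]cardsCs setCK.
rewrite subzn //= -cards_draws.
have tK (C : {set T}) : C \subset ~: t -> (t :|: C) :\: t = C.
  move=> Ct; rewrite setDUl setDv set0U; apply/setDidPl.
  by rewrite disjoints_subset.
have Kt (B : {set T}) : t \subset B -> t :|: B :\: t = B.
  move=> tB; apply/setP=> x; rewrite !inE.
  by case: (boolP (x \in t)) => //= /(subsetP tB).
rewrite -(card_in_imset (f := fun C => t :|: C)) => [|C D]; last first.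
  by rewrite !inE => /andP[/tK CK _] /andP[/tK DK _] tCD; rewrite -CK tCD DK.
apply/eq_card => B; rewrite !inE; apply/andP/imsetP.
  case=> /eqP Bk tB; exists (B :\: t); last by rewrite Kt.
  by rewrite inE subsetDr cardsD (setIidPr tB) Bk /=.
case=> C; rewrite inE => /andP[Ct /eqP Ck] ->; rewrite subsetUl; split => //.
move: (cardsID t (t :|: C)); rewrite (tK _ Ct) (setIidPr (subsetUl _ _)) Ck.
by move=> <-; rewrite subnKC.
Qed.

(** Inclusion-exclusion on the events of missing [x] and missing [y]; the terms on the right have
    the form computed by [cAE]. *)
Lemma sum_mem2 (V : zmodType) (T : finType) (f : {set T} -> V)
    (P : pred {set T}) (x y : T) :
  \sum_(S | P S && ([set x; y] \subset S)) f S =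
    \sum_(S | P S) f S - \sum_(S | P S && (S \subset ~: [set x])) f S
    - \sum_(S | P S && (S \subset ~: [set y])) f S
    + \sum_(S | P S && (S \subset ~: [set x; y])) f S.
Proof.
rewrite !big_mkcondr /= -!sumrB -big_split /=; apply: eq_bigr => S _.
rewrite ![S \subset ~: _]subsetC !subUset !sub1set !inE.
case: (x \in S); case: (y \in S); rewrite /= ?subr0 ?addr0 ?subrr //.
by rewrite sub0r addNr.
Qed.

(** On a [k]-set, the minor minus [b] is [a - b] for a hyperedge and 0 otherwise; sum this over the
    sets satisfying [P]. *)
Lemma mulr_subr_card_HA (F : comNzRingType) (v k : nat) (A : 'M[F]_v) (a b : F)
    (P : pred {set 'I_v}) :
  DA A k =i [:: a; b] -> a != b ->
  (a - b) * #|[set B in HA A k a | P B]|%:R =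
    \sum_(S : {set 'I_v} | (#|S| == k) && P S) \det (psubmx A S)
    - b * #|[set S : {set 'I_v} | (#|S| == k) && P S]|%:R.
Proof.
move=> DAab ab.
have card_sum (Q : pred {set 'I_v}) :
    #|[set S : {set 'I_v} | (#|S| == k) && Q S]|%:R =
    \sum_(S : {set 'I_v} | (#|S| == k) && Q S) 1 :> F.
  by rewrite -sum1_card natr_sum; apply: eq_bigl => S; rewrite inE.
have -> : [set B in HA A k a | P B] =
    [set S : {set 'I_v} | (#|S| == k) && (P S && (\det (psubmx A S) == a))].
  by apply/setP=> S; rewrite !inE andbAC andbA.
rewrite !card_sum !mulr_sumr -sumrB.
under eq_bigl do rewrite andbA.
rewrite big_mkcondr /=; apply: eq_bigr => S /andP[Sk _]; rewrite !mulr1.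
have : \det (psubmx A S) \in DA A k.
  by apply: image_f; rewrite inE.
rewrite DAab !inE; case: eqP => [-> //|_ /= /eqP ->].
by rewrite subrr.
Qed.

(** A diagonal pair already lies in class 0, so a second class containing it would make a diagonal
    entry of the all-ones matrix at least 2. *)
Lemma assoc_scheme_neq (F : numFieldType) (v d : nat) (X : assoc_scheme F v d)
    (i : 'I_d) (x y : 'I_v) :
  (x, y) \in X (lift ord0 i) -> x != y.
Proof.
move=> xyi; apply/eqP=> xy; rewrite {}xy in xyi.
have y0 : (y, y) \in X ord0.
  have := congr1 (fun M : 'M_v => M y y) (scheme_id X); rewrite !mxE eqxx.
  by case: (_ \in _) => // /eqP; rewrite eq_sym oner_eq0.
have := congr1 (fun M : 'M_v => M y y) (scheme_sum X); rewrite summxE mxE.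
rewrite (bigD1 ord0) //= (bigD1 (lift ord0 i)) //= !mxE y0 xyi.
under eq_bigr do rewrite mxE.
rewrite -natr_sum -!natrD => /eqP.
by rewrite (eqr_nat F _ 1).
Qed.

Theorem theorem3p1 (R : realType) (v d : nat) (X : assoc_scheme R[i] v d)
    (k : nat) (k_gt0 : (0 < k)%N)
    (A : 'M[R[i]]_v) (A_diag : diagonalizable A)
    (a b : R[i]) (DAab : DA A k =i [:: a; b]) (a_neq_b : a != b)
    (c0 c1 : R[i]) (c2 : 'I_d -> R[i])
    (c0P : forall s : {set 'I_v}, #|s| = 0%N -> cA A s k = c0)
    (c1P : forall s : {set 'I_v}, #|s| = 1%N -> cA A s k = c1)
    (c2P : forall (j : 'I_d) (s : {set 'I_v}),
       s \in pairs_of (X (lift ord0 j)) -> cA A s k = c2 j) :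
  exists lambda : 'I_d -> nat,
    PBIBD X k lambda (HA A k a) /\
    forall i : 'I_d,
      (lambda i)%:R =
        (-1) ^+ k / (a - b) * (c0 - 2 * c1 + c2 i)
        - b / (a - b) * (binz (v - 2) (k%:Z - 2))%:R.
Proof.
have card0 : #|(set0 : {set 'I_v})| = 0%N by rewrite cards0.
have sum0 : \sum_(S : {set 'I_v} | #|S| == k) \det (psubmx A S) =
    (-1) ^+ k * c0.
  rewrite -(c0P _ card0) cAE; apply: eq_bigl => S.
  by rewrite setC0 subsetT andbT.
have sum1 x : \sum_(S : {set 'I_v} | (#|S| == k) && (S \subset ~: [set x]))
    \det (psubmx A S) = (-1) ^+ k * c1.
  by rewrite -(c1P [set x]) ?cards1 // cAE.
have ab0 : a - b != 0 by rewrite subr_eq0.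
(* The right-hand side does not depend on [x], so all vertices have the same degree. *)
have degE x : (a - b) * #|[set B in HA A k a | x \in B]|%:R =
    (-1) ^+ k * (c0 - c1) - b * (binz (v - 1) (k%:Z - 1))%:R.
  rewrite mulr_subr_card_HA //; congr (_ - _ * _%:R).
    rewrite mulrBr -sum0 -(sum1 x).
    pose memx (S : {set 'I_v}) := x \in S.
    rewrite [\sum_(S : {set 'I_v} | #|S| == k) _](bigID memx) /=.
    under [X in _ = _ - X]eq_bigl do rewrite subsetC sub1set inE.
    by rewrite addrK.
  have := card_supersets [set x] k; rewrite cards1 card_ord => <-.
  by apply: eq_card => S; rewrite !inE sub1set.
have pairE i x y : (x, y) \in X (lift ord0 i) ->
    (a - b) * #|[set B in HA A k a | [set x; y] \subset B]|%:R =
    (-1) ^+ k * (c0 - 2 * c1 + c2 i) - b * (binz (v - 2) (k%:Z - 2))%:R.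
  move=> xyi; have xy := assoc_scheme_neq xyi.
  rewrite mulr_subr_card_HA //; congr (_ - _ * _%:R).
    rewrite sum_mem2 sum0 !sum1 -cAE (c2P i).
      by ring.
    by apply/imsetP; exists (x, y).
  by rewrite card_supersets cards2 xy card_ord.
(* The classes are nonempty, so [lambda i] can be read off at a chosen pair [p i]; by [pairE] every
   pair of the class gives the same count. *)
have pick_pair i : exists p : 'I_v * 'I_v, p \in X (lift ord0 i).
  exact/set0Pn/scheme_neq0.
pose p i := xchoose (pick_pair i).
have pP i : ((p i).1, (p i).2) \in X (lift ord0 i).
  by rewrite -surjective_pairing; apply: xchooseP.
exists (fun i => #|[set B in HA A k a | [set (p i).1; (p i).2] \subset B]|).
split; last first.
  move=> i; apply: (mulfI ab0); rewrite (pairE i) //.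
  by field.
split.
- by move=> B; rewrite inE => /andP[/eqP].
(* The common degree is positive: the value [a] is attained, so a hyperedge exists, and it has a
   vertex because [k] is positive. *)
- have : a \in DA A k by rewrite DAab mem_head.
  case/imageP=> B; rewrite inE => Bk aB.
  have [x xB] : exists x, x \in B by apply/card_gt0P; rewrite (eqP Bk).
  exists #|[set B in HA A k a | x \in B]|.
    by apply/card_gt0P; exists B; rewrite !inE Bk -aB eqxx.
  move=> y; apply/eqP; rewrite -(eqr_nat R[i]).
  by apply/eqP/(mulfI ab0); rewrite !degE.
- move=> i x y xyi; apply/eqP; rewrite -(eqr_nat R[i]).
  by apply/eqP/(mulfI ab0); rewrite !(pairE i).
Qed.
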